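(* Let $\sum_{k=1}^\infty x_k$ be a series of real numbers which, in its original order, converges statistically to $a\in\mathbb{R}$. Then $SR_{st.}(\sum x_k)=\mathrm{LPR}(\sum x_k)$. Consequently $SR_{st.}(\sum x_k)$ is one of the following: (1) the one-point set $\{a\}$; (2) $a+\lambda\mathbb{Z}=\{a+\lambda m : m\in\mathbb{Z}\}$ for some $\lambda\in\mathbb{R}$; (3) the whole $\mathbb{R}$.
   Context: A set $A\subset\mathbb{N}$ is negligible if $\lim_{n\to\infty}\frac{|A\cap\{1,\ldots,n\}|}{n}=0$. A real sequence $(s_n)_{n=1}^\infty$ converges statistically to $s\in\mathbb{R}$ if for every $\varepsilon>0$ the set $\{n: |s_n-s|>\varepsilon\}$ is negligible. A series $\sum x_k$ converges statistically to $s$ if its sequence of partial sums $s_n=\sum_{k=1}^n x_k$ converges statistically to $s$. The statistical sum range $SR_{st.}(\sum x_k)$ is the set of all $s\in\mathbb{R}$ for which there is a permutation $\pi$ of $\mathbb{N}$ such that the series $\sum_{k} x_{\pi(k)}$ converges statistically to $s$. The limit-point range $\mathrm{LPR}(\sum x_k)$ is the set of all $x\in\mathbb{R}$ for which there are a permutation $\pi$ of $\mathbb{N}$ and an increasing sequence of indices $(m_k)$ such that $x=\lim_{k\to\infty}\sum_{j=1}^{m_k}x_{\pi(j)}$. *)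

(* Defs.v *)
From HB Require Import structures.
From mathcomp Require Import all_boot all_order all_algebra.
From mathcomp Require Import all_classical all_reals all_analysis.

Set Implicit Arguments.
Unset Strict Implicit.
Unset Printing Implicit Defensive.

Import Order.TTheory GRing.Theory Num.Theory.
Import numFieldNormedType.Exports.
Local Open Scope classical_set_scope.
Local Open Scope ring_scope.

(* Here N = {1, 2, ...}. Sequences are functions on nat whose value at 0 is
   never used: every index below is at least 1. *)
Definition posn : set nat := [set n | (1 <= n)%N].

Definition posn_permutation (pi : nat -> nat) : Prop := set_bij posn posn pi.

Definition stat_negligible (R : realType) (A : set nat) : Prop :=
  (fun n : nat => (\sum_(1 <= k < n.+1 | k \in A) 1)%N%:R / n%:R : R)
    @ \oo --> (0 : R).

Definition stat_cvg (R : realType) (s : nat -> R) (l : R) : Prop :=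
  forall e : R, 0 < e -> stat_negligible R [set n | `|s n - l| > e].

Definition partial_sum (R : realType) (x : nat -> R) (n : nat) : R :=
  \sum_(1 <= k < n.+1) x k.

Definition stat_cvg_series (R : realType) (x : nat -> R) (s : R) : Prop :=
  stat_cvg (partial_sum x) s.

Definition SR_st (R : realType) (x : nat -> R) : set R :=
  [set s | exists pi : nat -> nat,
    posn_permutation pi /\ stat_cvg_series (fun k => x (pi k)) s].

Definition LPR (R : realType) (x : nat -> R) : set R :=
  [set y | exists (pi : nat -> nat) (m : nat -> nat),
    [/\ posn_permutation pi,
        forall k, posn (m k),
        {homo m : i j / (i < j)%N} &
        (fun k => partial_sum (fun j => x (pi j)) (m k)) @ \oo --> y]].

(* Main.v *)
Require Import Defs.
From HB Require Import structures.
From mathcomp Require Import all_boot all_order all_algebra.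
From mathcomp Require Import all_classical all_reals all_analysis.
From mathcomp Require Import lra zify.
Import Order.TTheory GRing.Theory Num.Theory.
Import numFieldNormedType.Exports.
Local Open Scope classical_set_scope.
Local Open Scope ring_scope.

(** Let [tail_sums x] be the set of reals that are approximated, arbitrarily
    well and arbitrarily late, by sums of [x] over finite sets of indices.
    Since late partial sums of the original series are frequently close to [a],
    [tail_sums x] is a closed subgroup of the reals, and both ranges are shown
    to equal [a + tail_sums x].  The inclusions [SR_st x `<=` LPR x] and
    [LPR x `<=` a + tail_sums x] are soft.  For [a + tail_sums x `<=` SR_st x]
    the rearrangement is built in finite stages.  At a stage the finite set [L]
    used so far has sum close to [y], and membership of [y - a] in [tail_sums x]
    yields a larger finite set containing any prescribed index, still with sum
    close to [y].  Before adding the missing indices one inserts a long block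
    of consecutive later indices, started at an index [M] after which the bad
    indices of the original series have small density in every window
    [M < i <= M + j]; so bad partial sums are rare throughout the stage. *)

(** * Counting bad indices and statistical convergence *)

Lemma mem_leq_bigmax (l : seq nat) (i : nat) : i \in l -> (i <= \max_(j <- l) j)%N.
Proof. by move=> il; rewrite (big_rem i) //= leq_maxl. Qed.

Lemma sub_in_count (T : eqType) (P Q : pred T) (s : seq T) :
  {in s, subpred P Q} -> (count P s <= count Q s)%N.
Proof.
move=> PQ; rewrite -[count P s](eq_in_count (a1 := predI P Q)) => [|i /PQ].
  by apply: sub_count => i /andP[].
by rewrite /=; case: (P i) => //= ->.
Qed.

(** With the denominator cleared, densities become bounds on counts, and counts add over consecutive
    intervals. *)
Lemma stat_negligibleP (R : realType) (P : pred nat) :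
  stat_negligible R [set n | P n] <->
  forall e : R, 0 < e -> exists n0, forall n, (n0 <= n)%N ->
    (count P (iota 1 n))%:R <= e * n%:R.
Proof.
have cntE n : (\sum_(1 <= k < n.+1 | k \in [set n | P n]) 1)%N
    = count P (iota 1 n).
  rewrite sum1_count /index_iota subSS subn0; apply: eq_count => k /=.
  by apply/idP/idP; rewrite inE.
split=> [/cvgrPdist_le cvg0 e e0|H].
  have [N _ HN] := cvg0 e e0; exists N.+1 => n Nn.
  have := HN n (ltnW Nn); rewrite /= cntE sub0r normrN ger0_norm; last first.
    by rewrite divr_ge0.
  by rewrite ler_pdivrMr // ltr0n (leq_trans _ Nn).
apply/cvgrPdist_le => e e0; have [n0 Hn0] := H e e0.
exists n0.+1 => // n /= n0n; rewrite cntE sub0r normrN ger0_norm; last first.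
  by rewrite divr_ge0.
by rewrite ler_pdivrMr ?Hn0 ?(ltnW n0n) // ltr0n (leq_trans _ n0n).
Qed.

Lemma stat_cvgP (R : realType) (s : nat -> R) (l : R) :
  stat_cvg s l <-> forall e d : R, 0 < e -> 0 < d ->
    exists n0, forall n, (n0 <= n)%N ->
      (count (fun k => e < `|s k - l|) (iota 1 n))%:R <= d * n%:R.
Proof.
split=> [H e d e0 d0|H e e0]; first by move: (H e e0) => /stat_negligibleP; apply.
by apply/stat_negligibleP => d; exact: H.
Qed.

Lemma exists_range_max (R : realType) (f : nat -> R) (n0 d : nat) :
  exists2 M, (n0 <= M)%N & forall n, (n0 <= n <= n0 + d)%N -> f n <= f M.
Proof.
elim: d => [|d [M n0M HM]].
  by exists n0 => // n; rewrite addn0 -eqn_leq => /eqP ->.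
have [lt|le] := ltP (f M) (f (n0 + d.+1)%N).
  exists (n0 + d.+1)%N => [|n /andP[n0n]]; first exact: leq_addr.
  rewrite leq_eqVlt => /predU1P[-> //|]; rewrite addnS ltnS => nd.
  by rewrite -addnS; apply: le_trans (ltW lt); rewrite HM ?n0n.
exists M => // n /andP[n0n]; rewrite leq_eqVlt => /predU1P[-> //|].
by rewrite addnS ltnS => nd; rewrite HM ?n0n.
Qed.

(* A maximum [M] of [n |-> count P (iota 1 n) - e * n] over [n0 <= n] starts a
   window on which every initial segment contains few elements of [P]. *)
Lemma exists_sparse_start (R : realType) (P : pred nat) (n0 : nat) (e : R) :
    0 < e ->
    (forall d : R, 0 < d -> exists n1, forall n, (n1 <= n)%N ->
      (count P (iota 1 n))%:R <= d * n%:R) ->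
  exists2 M, (n0 <= M)%N & forall j, (count P (iota M.+1 j))%:R <= e * j%:R.
Proof.
move=> e0 H; have [n1 Hn1] := H (e / 2) (divr_gt0 e0 (ltr0n _ 2)).
pose f n := (count P (iota 1 n))%:R - e * n%:R : R.
(* From [n2] on, the density bound [e / 2] and [2 * n0 <= n] give [f n <= - e * n0 <= f n0], so a
   maximum over a finite range is one over all [n0 <= n]. *)
pose n2 := maxn n1 (2 * n0)%N.
have fn2 n : (n2 <= n)%N -> f n <= f n0.
  rewrite geq_max => /andP[/Hn1 H1]; rewrite -(ler_nat R) natrM => H2.
  have h : 0 <= e * (n%:R - 2 * n0%:R) by rewrite mulr_ge0 ?subr_ge0 // ltW.
  have := ler0n R (count P (iota 1 n0)).
  by rewrite /f; nra.
have [M n0M HM] := exists_range_max R f n0 n2.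
have {fn2}fM n : (n0 <= n)%N -> f n <= f M.
  move=> n0n; have [nn2|/ltnW/fn2 fn] := leqP n n2.
    by rewrite HM // n0n (leq_trans nn2) ?leq_addl.
  by rewrite (le_trans fn) // HM // leqnn leq_addr.
exists M => // j; have := fM (M + j)%N (leq_trans n0M (leq_addr _ _)).
by rewrite /f iotaD add1n count_cat !natrD; lra.
Qed.

(** Density at most [1 / 2] forces the first index of a sparse window to be good. Starting there
    drops one index; since [j + 2 <= 2 * (j + 1)], the bound [d / 2] pays for it. *)
Lemma stat_cvg_start (R : realType) (s : nat -> R) (l : R) (n0 : nat) (e d : R) :
    stat_cvg s l -> 0 < e -> 0 < d ->
  exists M, [/\ (n0 <= M)%N, `|s M - l| <= e &
    forall j, (count (fun k => (e < `|s k - l|)%R) (iota M.+1 j))%:R <= d * j%:R].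
Proof.
move=> /stat_cvgP sl e0 d0; pose P k := e < `|s k - l|.
pose c : R := Num.min (d / 2) (1 / 2).
have c0 : 0 < c by rewrite lt_min; apply/andP; split; lra.
have cd : c <= d / 2 by rewrite ge_min lexx.
have c1 : c <= 1 / 2 by rewrite ge_min lexx orbT.
have [M n0M HM] := exists_sparse_start R P n0 c c0 (fun d => sl e d e0).
exists M.+1; split; first exact: leq_trans n0M _.
  have := HM 1%N; rewrite mulr1 /= addn0 /P; case: ltP => //= _; lra.
rewrite -/P; case=> [|j]; first by rewrite mulr0.
have := HM j.+2; rewrite (iotaD M.+1 1 j.+1) count_cat addn1 natrD.
set u := (count P _)%:R; set v := (count P _)%:R; rewrite -![_.+1%:R]natr1.
have := ler0n R j; have : 0 <= u by []; nra.
Qed.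

Lemma stat_cvg_frequently (R : realType) (s : nat -> R) (l : R) (n0 : nat) (e : R) :
  stat_cvg s l -> 0 < e -> exists2 n, (n0 <= n)%N & `|s n - l| <= e.
Proof.
move=> sl e0; have [M [n0M sM _]] := stat_cvg_start R s l n0 e e sl e0 e0.
by exists M.
Qed.

(** * Tail sums and the soft inclusions *)

Definition tail_sums {R : realType} (x : nat -> R) : set R :=
  [set d | forall (n : nat) (e : R), 0 < e -> exists D : seq nat,
    [/\ uniq D, all (ltn n) D & `|\sum_(i <- D) x i - d| <= e]].

Lemma partial_sumE (R : realType) (x : nat -> R) (n : nat) :
  partial_sum x n = \sum_(i <- iota 1 n) x i.
Proof. by rewrite /partial_sum /index_iota subSS subn0. Qed.

Lemma partial_sumD (R : realType) (x : nat -> R) (m n : nat) :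
  partial_sum x (m + n) = partial_sum x m + \sum_(i <- iota m.+1 n) x i.
Proof. by rewrite !partial_sumE iotaD big_cat add1n. Qed.

(** The same permutation works: good indices occur arbitrarily late for every tolerance, so they can
    be chosen recursively. *)
Lemma SR_st_sub_LPR (R : realType) (x : nat -> R) : SR_st x `<=` LPR x.
Proof.
move=> y [pi [pi_bij]]; rewrite /stat_cvg_series; set s := partial_sum _ => sy.
have /choice[g Hg] : forall p : nat * nat, exists n,
    (p.1 <= n)%N /\ `|s n - y| <= p.2.+1%:R^-1.
  move=> p.
  have [|n pn sn] := stat_cvg_frequently R s y p.1 p.2.+1%:R^-1 sy.
    by rewrite invr_gt0.
  by exists n.
pose m := fix m k := if k is k'.+1 then g ((m k').+1, k) else g (1%N, 0%N).
have m_lt k : (m k < m k.+1)%N by have [] := Hg ((m k).+1, k.+1).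
have m_close k : `|s (m k) - y| <= k.+1%:R^-1.
  by case: k => [|k]; [have [] := Hg (1, 0)%N | have [] := Hg ((m k).+1, k.+1)].
exists pi, m; split => //.
- case=> [|k]; first by have [] := Hg (1, 0)%N.
  exact: leq_trans (m_lt k).
- by apply: homo_ltn => //; exact: ltn_trans.
apply/cvgrPdist_le => e e0.
have [N _ HN] := (cvgrPdist_le _ _).1 (@cvg_harmonic R) e e0.
exists N => // k /HN /=; rewrite sub0r normrN ger0_norm ?invr_ge0 // => ke.
by rewrite distrC; exact: le_trans ke.
Qed.

Lemma posn_permutation_surj_bound (pi : nat -> nat) (n : nat) :
    posn_permutation pi ->
  exists J, forall i, (0 < i <= n)%N -> exists2 j, (0 < j <= J)%N & pi j = i.
Proof.
case=> _ _ pi_surj; elim: n => [|n [J HJ]]; first by exists 0%N => -[].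
have [j j0 pij] := pi_surj n.+1 isT.
exists (maxn J j) => i /andP[i0]; rewrite leq_eqVlt => /predU1P[->|].
  by exists j => //; rewrite leq_maxr andbT.
rewrite ltnS => ile; have [|j' /andP[j'0 j'J] <-] := HJ i; first by rewrite i0.
by exists j' => //; rewrite j'0 leq_max j'J.
Qed.

(** A long rearranged partial sum close to [y] contains all of [x 1, ..., x n'], whose sum is close
    to [a] for suitable [n']. What remains is a sum close to [y - a] over indices beyond [n']. *)
Lemma LPR_sub_tail_sums (R : realType) (x : nat -> R) (a y : R) :
  stat_cvg_series x a -> LPR x y -> tail_sums x (y - a).
Proof.
move=> xa [pi [m [pi_bij m_pos m_homo sy]]] n e e0.
have e20 : 0 < e / 2 by rewrite divr_gt0.
have [n' nn' sn'] := stat_cvg_frequently R _ a n (e / 2) xa e20.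
have [J HJ] := posn_permutation_surj_bound pi n' pi_bij.
have [N _ HN] := (cvgrPdist_le _ _).1 sy (e / 2) e20.
pose k := maxn J N; have km : (k <= m k)%N.
  elim: {+}k => // k' IH; exact: leq_ltn_trans (m_homo _ _ (ltnSn _)).
pose l := [seq pi i | i <- iota 1 (m k)].
have [pi_fun pi_inj _] := pi_bij.
have l_uniq : uniq l.
  rewrite map_inj_in_uniq ?iota_uniq // => i j.
  rewrite !mem_iota => /andP[i0 _] /andP[j0 _].
  by apply: pi_inj; rewrite inE.
exists [seq i <- l | (n' < i)%N]; split.
- exact: filter_uniq.
- by apply/allP => i; rewrite mem_filter => /andP[n'i _]; exact: leq_ltn_trans n'i.
have l_low : perm_eq [seq i <- l | ~~ (n' < i)%N] (iota 1 n').
  apply: uniq_perm; rewrite ?filter_uniq ?iota_uniq // => i.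
  rewrite mem_filter mem_iota -leqNgt add1n ltnS andbC.
  apply: andb_id2r => ile; apply/idP/idP => [/mapP[j]|i0].
    by rewrite mem_iota => /andP[j0 _] ->; exact: pi_fun.
  have [|j /andP[j0 jJ] <-] := HJ i; first by rewrite i0.
  apply: map_f; rewrite mem_iota j0 add1n ltnS (leq_trans jJ) //.
  by rewrite (leq_trans _ km) // leq_maxl.
have := HN k (leq_maxr _ _); move: sn'; rewrite /= !partial_sumE distrC.
rewrite -(big_map pi xpredT x) -/l -(perm_big _ l_low) /=.
rewrite !big_filter (bigID (fun i => n' < i)%N xpredT) /=.
set u := \sum_(_ <- _ | _) _; set v := \sum_(_ <- _ | _) _ => h1 h2.
rewrite ler_norml; move: h1 h2; rewrite !ler_norml => /andP[h1 h2] /andP[h3 h4].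
apply/andP; split; lra.
Qed.

(** * Closed subgroups of the real line *)

(** If the infimum of the positive elements is zero, multiples of small elements are dense; if it is
    positive, it lies in [G] by closedness and generates [G] by division with remainder. *)
Lemma closed_subgroup_trichotomy (R : realType) (G : set R) :
    G 0 -> (forall u v, G u -> G v -> G (u - v)) ->
    (forall z, (forall e, 0 < e -> exists2 g, G g & `|g - z| <= e) -> G z) ->
  [\/ G = [set 0], exists lambda : R, G = [set lambda * m%:~R | m in [set: int]]
    | G = [set: R]].
Proof.
move=> G0 GB Gcl.
have GN u : G u -> G (- u) by rewrite -sub0r; exact: GB.
have GD u v : G u -> G v -> G (u + v) by move=> Gu /GN/(GB _ _ Gu); rewrite opprK.
have GMn u (n : nat) : G u -> G (u *+ n).
  by move=> Gu; elim: n => // n IH; rewrite mulrS; exact: GD.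
have GMz u (m : int) : G u -> G (u * m%:~R).
  case: m => n Gu; first by rewrite -pmulrn mulr_natr; exact: GMn.
  by rewrite NegzE mulrNz mulrN -pmulrn mulr_natr; exact/GN/GMn.
pose P := [set g | G g /\ 0 < g].
have [[p Pp]|P0] := pselect (P !=set0); last first.
  apply: Or31; apply/seteqP; split=> [g Gg /=|_ ->//].
  apply/eqP; case: (ltgtP g 0) => // g0; exfalso; apply: P0.
    by exists (- g); split; [exact: GN | rewrite oppr_gt0].
  by exists g.
have P_inf : has_inf P by split; [exists p | exists 0 => g [_ /ltW]].
have lambda_ge0 : 0 <= inf P by apply: lb_le_inf; [exists p | move=> g [_ /ltW]].
have floorP (g z : R) : 0 < g -> 0 <= z - g * (Num.floor (z / g))%:~R < g.
  move=> g0; have := ge_floor (z / g); have := floorD1_gt (z / g).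
  rewrite ltr_pdivrMr // ler_pdivlMr // intrD mulrDl mul1r subr_ge0 ltrBlDl.
  by rewrite ![g * _]mulrC => -> ->.
move: lambda_ge0; rewrite le_eqVlt => /predU1P[lambda0|lambda_gt0].
  apply: Or33; apply/seteqP; split=> // z _; apply: Gcl => e e0.
  have [g [Gg g0]] := inf_adherent e0 P_inf; rewrite -lambda0 add0r => ge.
  exists (g * (Num.floor (z / g))%:~R); first exact: GMz.
  have /andP[h1 h2] := floorP g z g0.
  by rewrite distrC ger0_norm // ltW // (lt_trans h2).
have Glambda : G (inf P).
  apply: Gcl => e e0; have [g Pg ge] := inf_adherent e0 P_inf.
  exists g; first by case: Pg.
  rewrite ger0_norm; first by rewrite lerBlDl ltW.
  by rewrite subr_ge0; apply: ge_inf Pg; case: P_inf.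
apply: Or32; exists (inf P); apply/seteqP; split=> [z Gz|_ [m _ <-]].
  2: exact: GMz.
exists (Num.floor (z / inf P)) => //; apply/esym/eqP; rewrite -subr_eq0.
have /andP[h1 h2] := floorP (inf P) z lambda_gt0.
(* A nonzero remainder would be a positive element of [G] below [inf P]. *)
rewrite eq_le h1 andbT leNgt; apply/negP => h3.
have : inf P <= z - inf P * (Num.floor (z / inf P))%:~R.
  by apply: ge_inf; [case: P_inf | split=> //; apply: GB => //; exact: GMz].
by rewrite leNgt h2.
Qed.

(** * The tail sums form a closed subgroup *)

Lemma tail_sums0 (R : realType) (x : nat -> R) : tail_sums x 0.
Proof. by move=> n e e0; exists [::]; rewrite big_nil subr0 normr0 ltW. Qed.

Lemma tail_sumsD (R : realType) (x : nat -> R) (u v : R) :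
  tail_sums x u -> tail_sums x v -> tail_sums x (u + v).
Proof.
move=> xu xv n e e0; have e20 : 0 < e / 2 by rewrite divr_gt0.
have [D [D_uniq /allP D_gt Du]] := xu n _ e20.
(* Starting beyond [D] makes the second set disjoint from the first. *)
pose M := maxn n (\max_(j <- D) j).
have [D' [D'_uniq /allP D'_gt D'v]] := xv M _ e20.
exists (D ++ D'); split.
- rewrite cat_uniq D_uniq D'_uniq andbT; apply/hasPn => i /D'_gt /=.
  by rewrite gtn_max => /andP[_]; apply: contraL => /mem_leq_bigmax; rewrite leqNgt.
- rewrite all_cat; apply/andP; split; first exact/allP.
  by apply/allP => i /D'_gt /=; apply: leq_ltn_trans; exact: leq_maxl.
rewrite big_cat /= opprD addrACA (le_trans (ler_normD _ _)) //.
by rewrite [e]splitr lerD.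
Qed.

(* The complement of a finite set inside a long interval sums to nearly the
   opposite, since two late partial sums are close. *)
Lemma tail_sumsN (R : realType) (x : nat -> R) (a u : R) :
  stat_cvg_series x a -> tail_sums x u -> tail_sums x (- u).
Proof.
move=> xa xu n e e0; have e30 : 0 < e / 3 by rewrite divr_gt0.
have [n' nn' sn'] := stat_cvg_frequently R _ a n _ xa e30.
have [D [D_uniq /allP D_gt Du]] := xu n' _ e30.
have [M] := stat_cvg_frequently R _ a (maxn n' (\max_(j <- D) j)) _ xa e30.
rewrite geq_max => /andP[n'M DM] sM.
exists [seq i <- iota n'.+1 (M - n') | i \notin D]; split.
- by rewrite filter_uniq ?iota_uniq.
- by apply/allP => i; rewrite mem_filter mem_iota => /and3P[_ /(leq_ltn_trans nn')].
have DE : perm_eq [seq i <- iota n'.+1 (M - n') | i \in D] D.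
  apply: uniq_perm; rewrite ?filter_uniq ?iota_uniq // => i.
  rewrite mem_filter mem_iota; case iD: (i \in D) => //=.
  have /= -> := D_gt _ iD; rewrite addSn subnKC // ltnS.
  exact: leq_trans (mem_leq_bigmax _ _ iD) DM.
have := partial_sumD R x n' (M - n'); rewrite subnKC //.
rewrite (bigID [in D]) /= -big_filter (perm_big _ DE) /= big_filter => sME.
move: sn' sM Du; rewrite sME !ler_norml => /andP[? ?] /andP[? ?] /andP[? ?].
by apply/andP; split; lra.
Qed.

Lemma tail_sums_closed (R : realType) (x : nat -> R) (z : R) :
    (forall e, 0 < e -> exists2 g, tail_sums x g & `|g - z| <= e) ->
  tail_sums x z.
Proof.
move=> H n e e0; have e20 : 0 < e / 2 by rewrite divr_gt0.
have [g xg gz] := H _ e20; have [D [D_uniq D_gt Dg]] := xg n _ e20.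
exists D; split=> //.
by rewrite (le_trans (ler_distD g _ _)) // [e]splitr lerD.
Qed.

(** * Construction of the rearrangement in stages *)

(* Before paying for the missing indices [E], run through a stretch of the
   original series that is long enough to make [size E] negligible and that
   starts at a point after which bad partial sums are sparse. *)
Lemma extend_rearrangement (R : realType) (x : nat -> R) (a y e e' : R)
    (L : seq nat) (k : nat) :
    stat_cvg_series x a -> tail_sums x (y - a) -> 0 < e -> 0 < e' ->
    uniq L -> all (ltn 0) L ->
  exists T : seq nat,
    [/\ uniq (L ++ T), all (ltn 0) (L ++ T), k.+1 \in L ++ T,
        `|\sum_(i <- L ++ T) x i - y| <= e' &
        `|\sum_(i <- L) x i - y| <= e -> forall j, (j <= size T)%N ->
          (count (fun i => (3 * e < `|\sum_(h <- L ++ take i T) x h - y|)%R)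
            (iota 1 j))%:R <= 2 * e * j%:R].
Proof.
move=> xa xya e0 e'0 L_uniq /allP L_pos.
(* The final sum is off [y] by four errors: those of the partial sums at [n], [M] and [M'], and that
   of the sum over [D]. *)
pose r : R := Num.min e (e' / 4).
have r0 : 0 < r by rewrite lt_min e0 divr_gt0.
have re : r <= e by rewrite ge_min lexx.
have re' : r <= e' / 4 by rewrite ge_min lexx orbT.
have [n] := stat_cvg_frequently R _ a (maxn k.+1 (\max_(i <- L) i)) _ xa r0.
rewrite geq_max => /andP[kn Ln] sn.
have [D [D_uniq /allP D_gt Dya]] := xya n _ r0.
have [M []] := stat_cvg_start R _ a (maxn n (\max_(i <- D) i)) r e xa r0 e0.
rewrite geq_max => /andP[nM DM] sM M_sparse.
(* [G] contains [L] and [k.+1], and its sum is close to [a + (y - a)]. *)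
pose G := iota 1 n ++ D; pose E := [seq i <- G | i \notin L].
pose J0 := (Num.trunc ((size E)%:R / e : R)).+1.
have [M'] := stat_cvg_frequently R _ a (M + J0)%N _ xa r0.
move=> MM' sM'.
have [J ?] : exists J, M' = (M + J)%N by exists (M' - M)%N; lia.
subst M'; move: MM'; rewrite leq_add2l => J0J.
have EJ : (size E)%:R <= e * J%:R.
  rewrite mulrC -ler_pdivrMr // ltW // (lt_le_trans (truncnS_gt _)) //.
  by rewrite ler_nat.
have L_le i : i \in L -> (i <= n)%N.
  by move=> iL; exact: leq_trans (mem_leq_bigmax _ _ iL) Ln.
have G_uniq : uniq G.
  rewrite cat_uniq iota_uniq D_uniq andbT; apply/hasPn => i /D_gt /=.
  by rewrite mem_iota add1n ltnS => ni; rewrite (leqNgt i) ni andbF.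
have G_le i : i \in G -> (i <= M)%N.
  rewrite mem_cat mem_iota => /orP[/andP[_]|iD].
    by rewrite add1n ltnS => /leq_trans; apply.
  exact: leq_trans (mem_leq_bigmax _ _ iD) DM.
have G_pos i : i \in G -> (0 < i)%N.
  rewrite mem_cat mem_iota => /orP[/andP[]//|/D_gt/=]; exact: leq_ltn_trans.
have LE_uniq : uniq (L ++ E).
  rewrite cat_uniq L_uniq filter_uniq // andbT.
  by apply/hasPn => i; rewrite mem_filter => /andP[].
have LEG : L ++ E =i G.
  move=> i; rewrite mem_cat mem_filter; case iL: (i \in L) => //=.
  rewrite mem_cat mem_iota add1n ltnS (L_le i iL) andbT.
  by apply/esym/orP; left; exact: L_pos.
have LE_perm : perm_eq (L ++ E) G by exact: uniq_perm.
have T_perm : perm_eq (L ++ iota M.+1 J ++ E) (G ++ iota M.+1 J).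
  by rewrite (perm_catCA L) perm_catC perm_cat2r.
exists (iota M.+1 J ++ E); split.
- rewrite (perm_uniq T_perm) cat_uniq G_uniq iota_uniq andbT.
  apply/hasPn => i; rewrite mem_iota => /andP[Mi _].
  by apply/negP => /G_le; rewrite leqNgt Mi.
- rewrite (perm_all _ T_perm) all_cat; apply/andP; split; first exact/allP.
  by apply/allP => i; rewrite mem_iota => /andP[Mi _]; exact: leq_trans Mi.
- by rewrite (perm_mem T_perm) 2!mem_cat mem_iota add1n /= [(k.+1 < _)%N]ltnS kn.
- rewrite (perm_big _ T_perm) /= !big_cat /= -partial_sumE.
  move: sM' Dya sn sM; rewrite partial_sumD !ler_norml.
  move=> /andP[? ?] /andP[? ?] /andP[? ?] /andP[? ?].
  by apply/andP; split; lra.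
move=> Ly j; rewrite size_cat size_iota => jT.
set bad := fun i => _.
have bad_low j' : (j' <= J)%N -> (count bad (iota 1 j'))%:R <= e * j'%:R.
  move=> j'J; apply: le_trans (M_sparse j'); rewrite ler_nat.
  rewrite -[M.+1]addn1 [iota (M + 1) _]iotaDl count_map; apply: sub_in_count => i /=.
  rewrite mem_iota add1n ltnS => /andP[_ ij'] /=; rewrite /bad.
  have iJ := leq_trans ij' j'J.
  rewrite take_cat size_iota take_iota (minn_idPl iJ).
  have -> : (if (i < J)%N then iota M.+1 i else iota M.+1 J ++ take (i - J) E)
      = iota M.+1 i.
    case: ltnP => // Ji; have -> : i = J by apply/eqP; rewrite eqn_leq iJ.
    by rewrite subnn take0 cats0.
  (* The bound [3 * e] collects the errors of the sum over [L] and of the partial sums at [M] and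
     [M + i]. *)
  rewrite big_cat /= partial_sumD; apply: contraTT; rewrite -!leNgt.
  move: sM Ly; rewrite !ler_norml => /andP[? ?] /andP[? ?] /andP[? ?].
  by apply/andP; split; lra.
have [jJ|Jj] := leqP j J.
  have := bad_low j jJ; have : 0 <= e * j%:R by rewrite mulr_ge0 // ltW.
  by lra.
(* Even if all of [E] is counted as bad, it adds at most [e * J] to the count over the block. *)
rewrite -(subnKC (ltnW Jj)) iotaD count_cat !natrD.
have h1 := bad_low J (leqnn _).
have h2 : (count bad (iota (1 + J) (j - J)))%:R <= (size E)%:R :> R.
  by rewrite ler_nat (leq_trans (count_size _ _)) // size_iota leq_subLR.
have h3 : 0 <= e * (j - J)%:R by rewrite mulr_ge0 // ltW.
nra.
Qed.

(** Extensions with tolerances [1 / (k + 1)] are iterated; the nested lists [L k] together enumerate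
    every positive index once. In stage [k], deviations above [3 * r k] have density at most
    [2 * r k], and both bounds tend to zero. *)
Lemma tail_sums_sub_SR_st (R : realType) (x : nat -> R) (a y : R) :
  stat_cvg_series x a -> tail_sums x (y - a) -> SR_st x y.
Proof.
move=> xa xya; pose r (k : nat) : R := k.+1%:R^-1.
have r0 k : 0 < r k by rewrite invr_gt0.
have r_homo k k' : (k <= k')%N -> r k' <= r k.
  by move=> kk'; rewrite lef_pV2 ?posrE // ler_nat.
(* The invariants on the list are a premise inside the choice, so that [F] is total and [L] is a
   plain recursion. *)
have /choice[F HF] : forall p : nat * seq nat, exists T,
    uniq p.2 && all (ltn 0) p.2 ->
    [/\ uniq (p.2 ++ T), all (ltn 0) (p.2 ++ T), p.1.+1 \in p.2 ++ T,
        `|\sum_(i <- p.2 ++ T) x i - y| <= r p.1.+1 &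
        `|\sum_(i <- p.2) x i - y| <= r p.1 -> forall j, (j <= size T)%N ->
          (count (fun i => (3 * r p.1 < `|\sum_(h <- p.2 ++ take i T) x h - y|)%R)
            (iota 1 j))%:R <= 2 * r p.1 * j%:R].
  move=> [k L] /=; case: (boolP (_ && _)) => [/andP[L_uniq L_pos]|_].
  2: by exists [::].
  have [T HT] := extend_rearrangement R x a y (r k) (r k.+1) L k xa xya (r0 _)
    (r0 _) L_uniq L_pos.
  by exists T.
(* The empty list need not have sum within [r 0] of [y]; closeness is ensured only from stage [1]
   on, whence [0 < K] below. *)
pose L := fix L k := if k is k'.+1 then L k' ++ F (k', L k') else [::].
have L_ok k : uniq (L k) && all (ltn 0) (L k).
  by elim: k => // k /(HF (k, L k))[/= -> ->].
have L_uniq k : uniq (L k) by have /andP[] := L_ok k.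
have L_prefix k t : exists T, L (k + t)%N = L k ++ T.
  elim: t => [|t [T LT]]; first by exists [::]; rewrite addn0 cats0.
  by exists (T ++ F ((k + t)%N, L (k + t)%N)); rewrite addnS /= catA -LT.
have L_mem i k : (0 < i <= k)%N -> i \in L k.
  case: i => // i ik; have [T] := L_prefix i.+1 (k - i.+1)%N.
  rewrite subnKC // => ->; rewrite mem_cat.
  by have [/= _ _ ->] := HF (i, L i) (L_ok i).
have L_size k : (k <= size (L k))%N.
  rewrite -[X in (X <= _)%N](size_iota 1 k); apply: uniq_leq_size => [|i].
    exact: iota_uniq.
  by rewrite mem_iota add1n ltnS; exact: L_mem.
have nth_L k k' j : (j < size (L k))%N -> (k <= k')%N ->
    nth 0%N (L k') j = nth 0%N (L k) j.
  move=> jk kk'; have [T] := L_prefix k (k' - k)%N.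
  by rewrite subnKC // => ->; rewrite nth_cat jk.
(* Positions start at [1], and [L i] has at least [i] entries, so the default of [nth] is never
   reached for [0 < i]. *)
pose pi i := nth 0%N (L i) i.-1.
have pi_nth k j : (j < size (L k))%N -> pi j.+1 = nth 0%N (L k) j.
  move=> jk; have [kj|/ltnW jk'] := leqP k j.+1.
    exact: (nth_L k j.+1 j).
  by apply/esym/(nth_L j.+1 k j) => //; exact: L_size.
have pi_take k p : (p <= size (L k))%N -> [seq pi i | i <- iota 1 p] = take p (L k).
  move=> pk; rewrite -(map_nth_iota0 0%N pk) (iotaDl 1 0) -map_comp.
  apply/eq_in_map => j; rewrite mem_iota add0n => /= jp.
  by rewrite add1n; apply: pi_nth; exact: leq_trans pk.
exists pi; split.
  split=> [[//|i] _|i j|i i0] /=.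
  - have /andP[_ /allP] := L_ok i.+1; apply.
    by rewrite (pi_nth i.+1) ?mem_nth //; exact: L_size.
  - rewrite !inE; case: i j => [|i] [|j] // _ _; pose k := maxn i.+1 j.+1.
    have ik : (i < size (L k))%N by rewrite (leq_trans _ (L_size _)) // leq_maxl.
    have jk : (j < size (L k))%N by rewrite (leq_trans _ (L_size _)) // leq_maxr.
    rewrite (pi_nth k) // (pi_nth k j) // => /eqP.
    by rewrite nth_uniq // => /eqP ->.
  - have iL : i \in L i by rewrite L_mem // leqnn andbT.
    exists (index i (L i)).+1 => //.
    by rewrite (pi_nth i) ?index_mem // nth_index.
rewrite /stat_cvg_series; set S := partial_sum _.
have SE k p : (p <= size (L k))%N -> S p = \sum_(i <- take p (L k)) x i.
  by move=> pk; rewrite /S partial_sumE -(pi_take k p pk) big_map.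
apply/stat_cvgP => e d e0 d0; pose bad k := e < `|S k - y|.
(* Half of [d] covers the stages from [K] on; the other half absorbs the finitely many earlier
   positions once [n] is large. *)
have [K K0 [Ke Kd]] : exists2 K, (0 < K)%N & 3 * r K <= e /\ 2 * r K <= d / 2.
  pose m : R := Num.min (e / 3) (d / 4).
  have m0 : 0 < m by rewrite lt_min; apply/andP; split; lra.
  have me : m <= e / 3 by rewrite ge_min lexx.
  have md : m <= d / 4 by rewrite ge_min lexx orbT.
  have [N _ HN] := (cvgrPdist_le _ _).1 (@cvg_harmonic R) m m0.
  have h : r N.+1 <= m.
    by have := HN N.+1 (leqnSn _); rewrite /= sub0r normrN ger0_norm ?invr_ge0.
  by exists N.+1 => //; split; lra.
pose sK := size (L K).
(* Complete stages add up, and an unfinished last stage does no harm because the extension bound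
   holds on each of its initial segments. *)
have sparse t p : (sK <= p <= size (L (K + t)))%N ->
    (count bad (iota sK.+1 (p - sK)))%:R <= d / 2 * (p - sK)%:R.
  elim: t p => [|t IH] p.
    by rewrite addn0 -eqn_leq => /eqP <-; rewrite subnn mulr0.
  rewrite addnS; set k := (K + t)%N in IH *; move=> /andP[sKp pk].
  have sKk : (sK <= size (L k))%N.
    by have [T ->] := L_prefix K t; rewrite size_cat leq_addr.
  have [pk'|kp] := leqP p (size (L k)); first by rewrite IH // sKp.
  have [j pE] : exists j, p = (size (L k) + j)%N.
    by exists (p - size (L k))%N; rewrite subnKC // ltnW.
  have -> : (p - sK = (size (L k) - sK) + j)%N by lia.
  rewrite iotaD count_cat !natrD mulrDr lerD //; first by rewrite IH // sKk leqnn.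
  rewrite addSn subnKC //.
  have jT : (j <= size (F (k, L k)))%N.
    by move: pk; rewrite pE /= size_cat leq_add2l.
  have Lky : `|\sum_(i <- L k) x i - y| <= r k.
    have [k' kE] : exists k', k = k'.+1 by exists k.-1; rewrite /k; lia.
    by rewrite kE; have [] := HF (k', L k') (L_ok k').
  have [_ _ _ _ /(_ Lky j jT) /= h] := HF (k, L k) (L_ok k).
  have rk : 2 * r k <= d / 2.
    by apply: le_trans Kd; rewrite ler_pM2l // r_homo // leq_addr.
  apply: (@le_trans _ _ (2 * r k * j%:R)); last by rewrite ler_wpM2r.
  apply: le_trans h; rewrite ler_nat -[(size (L k)).+1]addn1 [iota (size _ + 1) _]iotaDl count_map.
  apply: sub_in_count => i /=; rewrite mem_iota add1n ltnS => /andP[_ ij] /=.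
  rewrite /bad (SE k.+1); last by rewrite /= size_cat leq_add2l (leq_trans ij).
  rewrite /= take_cat ltnNge leq_addr /= addKn; apply: le_lt_trans.
  by apply: le_trans Ke; rewrite ler_pM2l // r_homo // leq_addr.
pose n0 := (Num.trunc (2 * sK%:R / d)).+1.
exists (maxn sK n0) => n; rewrite geq_max => /andP[sKn n0n].
have h1 : sK%:R <= d / 2 * n%:R.
  have : 2 * sK%:R / d <= n%:R.
    by rewrite ltW // (lt_le_trans (truncnS_gt _)) // ler_nat.
  by rewrite ler_pdivrMr //; lra.
have /(sparse n) h2 : (sK <= n <= size (L (K + n)))%N.
  by rewrite sKn (leq_trans (leq_addl K n)).
rewrite -/bad -(subnKC sKn) iotaD count_cat add1n natrD.
have h3 : (count bad (iota 1 sK))%:R <= sK%:R :> R.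
  by rewrite ler_nat (leq_trans (count_size _ _)) // size_iota.
have h4 : 0 <= d * sK%:R by rewrite mulr_ge0 // ltW.
rewrite subnKC //; move: h1; rewrite -{1 3}(subnKC sKn) natrD; lra.
Qed.

Theorem theorem2p2p1 (R : realType) (x : nat -> R) (a : R)
    (x_cvg : stat_cvg_series x a) :
  SR_st x = LPR x /\
  [\/ SR_st x = [set a],
      exists lambda : R, SR_st x = [set a + lambda * m%:~R | m in [set: int]]
    | SR_st x = [set: R]].
Proof.
(* The inclusions run in a cycle from [SR_st x] through [LPR x] to the translate of [tail_sums x]
   and back, so all three sets agree. *)
have SR_tail : SR_st x = [set y | tail_sums x (y - a)].
  apply/seteqP; split=> [y /SR_st_sub_LPR|y]; first exact: LPR_sub_tail_sums.
  exact: tail_sums_sub_SR_st.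
split.
  apply/seteqP; split; first exact: SR_st_sub_LPR.
  by rewrite SR_tail => y; exact: LPR_sub_tail_sums.
rewrite SR_tail.
have [|u v xu /(tail_sumsN R x a v x_cvg)||tE|[lambda tE]|tE] :=
  @closed_subgroup_trichotomy R (tail_sums x).
- exact: tail_sums0.
- exact: tail_sumsD.
- exact: tail_sums_closed.
- apply: Or31; rewrite tE; apply/seteqP; split=> y /= => [/eqP|->].
    by rewrite subr_eq0 => /eqP.
  exact: subrr.
- apply: Or32; exists lambda; rewrite tE.
  apply/seteqP; split=> y /= [m _ mE]; exists m => //.
    by rewrite mE addrC subrK.
  by rewrite -mE addrAC subrr add0r.
- by apply: Or33; rewrite tE; apply/seteqP; split.
Qed.
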